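(* Let $n$ and $k$ be integers with $k\ge 2$ and $n\ge 2k+1$. Then the total mutual-visibility number of the bipartite Kneser graph $H(n,k)$ is $$\mu_{\rm t}(H(n,k))=\begin{cases} 0 & \text{if } 2k+1\le n\le 3k,\\ 2\binom{n}{k}-2\,C(n,n-k,2k) & \text{if } 3k+1\le n<2k^2+k,\\ 2\binom{n}{k}-4k-2 & \text{if } 2k^2+k\le n.\end{cases}$$
   Context: Bipartite Kneser graph: for $n>2k$, $H(n,k)$ has as vertices the $k$-element subsets and the $(n-k)$-element subsets of $[n]=\{1,\dots,n\}$; two distinct vertices are adjacent if and only if one of the represented sets is a subset of the other. Total mutual-visibility: Let $G$ be a connected graph and $\mathcal X\subseteq V(G)$. Two vertices $u,v\in V(G)$ are $\mathcal X$-visible if there is a shortest $u,v$-path $P$ in $G$ with no internal vertex in $\mathcal X$, i.e. $V(P)\cap\mathcal X\subseteq\{u,v\}$. The set $\mathcal X$ is a total mutual-visibility set if any two vertices of $V(G)$ are $\mathcal X$-visible. The total mutual-visibility number $\mu_{\rm t}(G)$ is the largest cardinality of a total mutual-visibility set in $G$. Covering number: For positive integers $n\ge m\ge t$, $C(n,m,t)$ is the minimum number of blocks in a collection $\mathcal B$ of $m$-element subsets (blocks) of an $n$-element set $X$ such that every $t$-element subset of $X$ is contained in at least one block of $\mathcal B$. *)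

(* Defs.v *)
From mathcomp Require Import all_boot all_order all_algebra.
From mathcomp Require Import boolp.

Set Implicit Arguments.
Unset Strict Implicit.
Unset Printing Implicit Defensive.

Section TotalMutualVisibility.
Variables (V : finType) (e : rel V).

(* The walk [u :: p] ends at [v]; being of minimum length among all walks from
   [u] to [v], it repeats no vertex, so it is a path. *)
Definition shortest_path (u v : V) (p : seq V) : Prop :=
  [/\ path e u p, last u p = v &
      forall q : seq V, path e u q -> last u q = v -> size p <= size q].

Definition visible (X : {set V}) (u v : V) : Prop :=
  exists2 p : seq V, shortest_path u v p &
    forall w : V, w \in u :: p -> w \in X -> w = u \/ w = v.

Definition total_mutual_visibility_set (X : {set V}) : Prop :=
  forall u v : V, visible X u v.

(* If the graph is connected, [set0] is a total mutual-visibility set, so the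
   maximum is over a nonempty family. *)
Definition total_mutual_visibility_number : nat :=
  \max_(X : {set V} | `[< total_mutual_visibility_set X >]) #|X|.

End TotalMutualVisibility.

Notation bipartite_kneser_vertex n k :=
  {A : {set 'I_n} | (#|A| == k) || (#|A| == n - k)}.

Definition bipartite_kneser (n k : nat) : rel (bipartite_kneser_vertex n k) :=
  fun u v => (u != v) && ((val u \subset val v) || (val v \subset val u)).

Definition is_covering (n m t : nat) (B : {set {set 'I_n}}) : bool :=
  [forall A in B, #|A| == m] &&
  [forall T : {set 'I_n}, (#|T| == t) ==> [exists A in B, T \subset A]].

(* If [t <= m <= n], the family of all [m]-subsets, used as the starting point
   of the minimization, is a covering; outside that range the value is
   meaningless. *)
Definition covering_number (n m t : nat) : nat :=
  #|[arg min_(B < [set A : {set 'I_n} | #|A| == m] | is_covering m t B) #|B|]|.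

(* Main.v *)
Require Import Defs.
From mathcomp Require Import all_boot all_order all_algebra.
From mathcomp Require Import boolp zify.

(** Call the [k]-sets small and the [(n - k)]-sets large.  Complementation is an
    automorphism of the graph that exchanges the two layers, so every argument
    is made for one layer and transported to the other along [compl].

    Two distinct small vertices whose union has at most [n - k] elements are at
    distance 2, and the paths of length 2 between them run through the large
    sets that contain their union.  Every set [T] with [k < #|T| <= 2 * k] is
    the union of two distinct [k]-sets.  Hence, if [X] is a total
    mutual-visibility set and moreover [#|T| <= n - k], some large set outside
    [X] contains [T] ([unblocked_superset]).

    If [n <= 3 * k], a large set [B] may itself be taken for [T]; the only
    large set containing [B] is [B], so [B] is not in [X].  By complementation
    [X] is empty ([total_mutual_visibility_set_empty]).

    If [3 * k <= n], taking for [T] all sets of [2 * k] elements shows that the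
    large sets outside [X] form a covering, and so do the complements of the
    small sets outside [X].  Conversely these two coverings suffice
    ([covering_total_mutual_visibility]): they give the middle vertex between
    two vertices of the same layer, and the two inner vertices of a path of
    length 3 between nonadjacent vertices of different layers are chosen one
    after the other.  So at least [2 * C(n, n - k, 2k)] of the [2 * 'C(n, k)]
    vertices lie outside [X], and equality is reached by leaving out the blocks
    of one minimum covering and their complements
    ([total_mutual_visibility_number_covering]).

    Finally, if no [t]-set meets all members of a family of [k]-sets, the
    family has more than [t] members, and [t + 1] disjoint [k]-sets form such a
    family; they exist as soon as [(t + 1) * k <= n].  For [t = 2 * k] this bound is
    [2 * k ^ 2 + k <= n], and then the covering number is [2 * k + 1]
    ([covering_number_disjoint_complements]). *)

Set Implicit Arguments.
Unset Strict Implicit.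
Unset Printing Implicit Defensive.

(** * Short shortest paths *)

Section Visibility.
Variables (V : finType) (e : rel V).
Implicit Types (u v w : V) (X : {set V}).

Lemma visible_refl X u : visible e X u u.
Proof.
by exists [::]; first split; first [left; apply/eqP; rewrite -mem_seq1 | done].
Qed.

Lemma visible_edge X u v : u != v -> e u v -> visible e X u v.
Proof.
move=> neq euv; exists [:: v].
  split=> //=; first by rewrite euv.
  by case=> //= _ uv; rewrite uv eqxx in neq.
by move=> w; rewrite !inE => /orP[]/eqP-> _; [left | right].
Qed.

Lemma visible_path2 X u v w :
  u != v -> ~~ e u v -> e u w -> e w v -> w \notin X -> visible e X u v.
Proof.
move=> neq nuv euw ewv wX; exists [:: w; v].
  split=> //=; first by rewrite euw ewv.
  case=> [|a [|b q]] //=; first by move=> _ uv; rewrite uv eqxx in neq.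
  by rewrite andbT => eua av; rewrite -av eua in nuv.
move=> z; rewrite !inE => /or3P[]/eqP-> zX; [by left | | by right].
by rewrite zX in wX.
Qed.

Lemma visible_path3 X u v w1 w2 :
    u != v -> ~~ e u v -> (forall w, e u w -> ~~ e w v) ->
    e u w1 -> e w1 w2 -> e w2 v -> w1 \notin X -> w2 \notin X ->
  visible e X u v.
Proof.
move=> neq nuv nuwv eu1 e12 e2v w1X w2X; exists [:: w1; w2; v].
  split=> //=; first by rewrite eu1 e12 e2v.
  case=> [|a [|b [|c q]]] //=; first by move=> _ uv; rewrite uv eqxx in neq.
    by rewrite andbT => eua av; rewrite -av eua in nuv.
  case/and3P=> eua eab _ bv.
  by have := nuwv _ eua; rewrite -bv eab.
move=> z; rewrite !inE => /or4P[]/eqP-> zX; [by left | | | by right].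
  by rewrite zX in w1X.
by rewrite zX in w2X.
Qed.

(** At distance 2 a shortest path has exactly one inner vertex, and it is a
    common neighbour distinct from both ends, so visibility keeps it out of
    [X]. *)
Lemma visible_at_distance2 X u v w :
    irreflexive e -> u != v -> ~~ e u v -> e u w -> e w v ->
    visible e X u v ->
  exists2 z, e u z && e z v & z \notin X.
Proof.
move=> irr neq nuv euw ewv [p [pp pv pmin] pX].
have := pmin [:: w; v]; rewrite /= euw ewv => /(_ isT erefl).
case: p pp pv pX {pmin} => [|z [|z' []]] //=.
- by move=> _ uv; rewrite uv eqxx in neq.
- by rewrite andbT => euz zv; rewrite -zv euz in nuv.
rewrite andbT => /andP[euz ezz'] <- pX _; exists z; first by rewrite euz.
apply/negP=> zX; case: (pX z _ zX) => [|zu|zz']; first by rewrite !inE eqxx orbT.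
  by rewrite zu irr in euz.
by rewrite -zz' irr in ezz'.
Qed.

Section Involution.
Variable f : V -> V.
Hypotheses (fK : involutive f) (fe : forall u v, e (f u) (f v) = e u v).

Lemma path_map_involution u p : path e (f u) (map f p) = path e u p.
Proof. by rewrite path_map; apply: eq_path => x y /=. Qed.

Lemma visible_imset X u v : visible e X u v -> visible e (f @: X) (f u) (f v).
Proof.
case=> p [pp pv pmin] pX; exists (map f p).
  split; [by rewrite path_map_involution | by rewrite last_map pv |].
  move=> q qq qv; rewrite size_map -(size_map f q); apply: pmin.
    by rewrite -path_map_involution mapK.
  by rewrite -(fK u) last_map qv fK.
move=> w wp /imsetP[x xX wx]; move: wp; rewrite wx -map_cons mem_map; last first.
  exact: inv_inj.
by move=> xp; case: (pX x xp xX) => ->; [left | right].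
Qed.

Lemma total_mutual_visibility_imset X :
  total_mutual_visibility_set e X -> total_mutual_visibility_set e (f @: X).
Proof. by move=> tX u v; rewrite -(fK u) -(fK v); apply: visible_imset. Qed.

End Involution.
End Visibility.

(** * Coverings *)

Lemma set_between (T : finType) (A B : {set T}) (m : nat) :
    A \subset B -> #|A| <= m <= #|B| ->
  exists2 C : {set T}, (A \subset C) && (C \subset B) & #|C| = m.
Proof.
move=> AB /andP[Am mB].
have sD : size (take (m - #|A|) (enum (B :\: A))) = m - #|A|.
  by rewrite size_takel // -cardE cardsDS // leq_sub2r.
have dD : [disjoint A & [set x in take (m - #|A|) (enum (B :\: A))]].
  rewrite -setI_eq0; apply/eqP/setP=> x; rewrite !inE; apply/negbTE/andP=> -[xA].
  by move/mem_take; rewrite mem_enum inE xA.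
exists (A :|: [set x in take (m - #|A|) (enum (B :\: A))]).
  rewrite subsetUl subUset AB /=; apply/subsetP=> x; rewrite inE => /mem_take.
  by rewrite mem_enum inE => /andP[].
rewrite cardsU; move: dD; rewrite -setI_eq0 => /eqP->; rewrite cards0 subn0.
rewrite cardsE (card_uniqP _) ?sD ?subnKC //.
by rewrite take_uniq // enum_uniq.
Qed.

Section Covering.
Variables (n m t : nat).
Implicit Types (B : {set {set 'I_n}}) (T A : {set 'I_n}).

(** A set smaller than [t] is first enlarged to a [t]-set; this is where
    [t <= n] matters. *)
Lemma covering_superset B T :
  t <= n -> is_covering m t B -> #|T| <= t -> exists2 A, A \in B & T \subset A.
Proof.
move=> tn /andP[_ /forallP covB] Tt.
have [|T' /andP[TT' _] T't] := @set_between _ T setT t (subsetT T).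
  by rewrite Tt cardsT card_ord.
have := covB T'; rewrite T't eqxx => /existsP[A /andP[AB T'A]].
by exists A => //; apply: subset_trans T'A.
Qed.

Lemma covering_block_card B A : is_covering m t B -> A \in B -> #|A| = m.
Proof. by move=> /andP[/forallP/(_ A)/implyP cB _] /cB/eqP. Qed.

Hypothesis (tm : t <= m) (mn : m <= n).

Lemma covering_all_subsets : @is_covering n m t [set A : {set 'I_n} | #|A| == m].
Proof.
apply/andP; split; first by apply/forallP=> A; apply/implyP; rewrite inE.
apply/forallP=> T; apply/implyP=> /eqP Tt.
have [|A /andP[TA _] Am] := @set_between _ T setT m (subsetT T).
  by rewrite Tt tm cardsT card_ord.
by apply/existsP; exists A; rewrite inE Am eqxx.
Qed.

Lemma covering_number_le B : is_covering m t B -> covering_number n m t <= #|B|.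
Proof.
rewrite /covering_number; case: arg_minnP; first exact: covering_all_subsets.
by move=> B' _; apply.
Qed.

Lemma covering_number_attained :
  exists2 B : {set {set 'I_n}}, is_covering m t B & #|B| = covering_number n m t.
Proof.
rewrite /covering_number; case: arg_minnP; first exact: covering_all_subsets.
by move=> B cB _; exists B.
Qed.

(** If there were at most [t] blocks, a point outside each of them would give a
    set of at most [t] points contained in no block. *)
Lemma covering_number_lb : m < n -> t < covering_number n m t.
Proof.
move=> mltn; have [B cB <-] := covering_number_attained.
rewrite ltnNge; apply/negP=> Bt.
have tn : t <= n by apply: leq_trans mn.
have x0 : 'I_n by case: (n) mltn => // n' _; exact: ord0.
(* The default [x0] is never reached on a block, which is a proper subset. *)
pose out A := odflt x0 [pick x in ~: A].
have [|A AB outA] := @covering_superset B (out @: B) tn cB.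
  by rewrite (leq_trans _ Bt) ?leq_imset_card.
have := subsetP outA _ (imset_f out AB).
rewrite /out; case: pickP => [x|A_full _] /=; first by rewrite inE => /negbTE->.
have := cardsC A; rewrite card_ord (covering_block_card cB AB).
have -> : #|~: A| = 0 by apply: eq_card0.
lia.
Qed.

End Covering.

(** The complements of [t + 1] disjoint [k]-sets form a covering: a [t]-set
    misses one of those [k]-sets. *)
Lemma covering_number_disjoint_complements (n k t : nat) :
  0 < k -> t.+1 * k <= n -> covering_number n (n - k) t = t.+1.
Proof.
move=> k0 tkn.
have tn : t <= n - k by move: tkn; nia.
have kn : k <= n by move: tkn; nia.
have nkn : n - k < n by lia.
apply/eqP; rewrite eqn_leq covering_number_lb ?leq_subr // andbT.
pose part (x : 'I_n) : 'I_t.+1 := inord (x %/ k).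
(* The [i]-th part is the interval from [i * k] to [i * k + k - 1]. *)
pose P (i : 'I_t.+1) := [set x : 'I_n | x %/ k == i].
have cardP i : #|P i| = k.
  have bnd (j : 'I_k) : i * k + j < n.
    have [it jk] := (ltn_ord i, ltn_ord j); nia.
  have -> : P i = (fun j : 'I_k => Ordinal (bnd j)) @: setT.
    apply/setP=> x; rewrite inE; apply/eqP/imsetP=> [xi|[j _ ->]] /=.
      exists (Ordinal (ltn_pmod x k0)) => //; apply: val_inj => /=.
      by rewrite -xi -divn_eq.
    by rewrite divnMDl // divn_small ?addn0.
  rewrite card_imset ?cardsT ?card_ord // => j1 j2 /(congr1 val) /= /addnI.
  exact: val_inj.
rewrite (leq_trans (covering_number_le _ _ (B := [set ~: P i | i in setT]) _)) //.
- exact: leq_subr.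
- apply/andP; split.
    apply/forallP=> A; apply/implyP=> /imsetP[i _ ->].
    by rewrite cardsCs setCK cardP card_ord.
  apply/forallP=> T; apply/implyP=> /eqP Tt.
  have [i iT] : exists i : 'I_t.+1, i \notin [set part x | x in T].
    apply/existsP; rewrite -negb_forall; apply/negP=> /forallP all_hit.
    have: #|[set: 'I_t.+1]| <= #|[set part x | x in T]|.
      by apply/subset_leq_card/subsetP=> i _; apply: all_hit.
    move/leq_trans/(_ (leq_imset_card _ _)); rewrite cardsT card_ord Tt.
    by rewrite ltnn.
  apply/existsP; exists (~: P i); rewrite (imset_f (fun i => ~: P i)) ?inE //=.
  apply/subsetP=> x xT; rewrite !inE; apply: contra iT => /eqP xi.
  by apply/imsetP; exists x => //; rewrite /part xi inord_val.
by rewrite (leq_trans (leq_imset_card _ _)) // cardsT card_ord.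
Qed.

(** * Total mutual-visibility sets of the bipartite Kneser graph *)

Section BipartiteKneser.
Variables (n k : nat).
Hypotheses (k0 : 0 < k) (k2n : 2 * k < n).

Local Notation vertex := (bipartite_kneser_vertex n k).
Local Notation H := (@bipartite_kneser n k).
Implicit Types (u v w : vertex) (X : {set vertex}) (A B T : {set 'I_n}).

Lemma small_subproof A : #|A| = k -> (#|A| == k) || (#|A| == n - k).
Proof. by move->; rewrite eqxx. Qed.

Lemma large_subproof A : #|A| = n - k -> (#|A| == k) || (#|A| == n - k).
Proof. by move->; rewrite eqxx orbT. Qed.

Definition small A (hA : #|A| = k) : vertex := exist _ A (small_subproof hA).
Definition large A (hA : #|A| = n - k) : vertex := exist _ A (large_subproof hA).

Lemma cardsC_ord A : #|~: A| = n - #|A|.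
Proof. by rewrite cardsCs setCK card_ord. Qed.

Lemma compl_subproof v : (#|~: val v| == k) || (#|~: val v| == n - k).
Proof. by case: v => A /= /orP[]/eqP hA; rewrite cardsC_ord hA; lia. Qed.

Definition compl v : vertex := exist _ (~: val v) (compl_subproof v).

Lemma complK : involutive compl.
Proof. by move=> v; apply: val_inj; rewrite /= setCK. Qed.

Lemma adj_compl u v : H (compl u) (compl v) = H u v.
Proof.
rewrite /bipartite_kneser (inj_eq (inv_inj complK)) /= !setCS.
by rewrite [X in _ && X]orbC.
Qed.

Lemma adj_irr : irreflexive H.
Proof. by move=> u; rewrite /bipartite_kneser eqxx. Qed.

Lemma adj_sym u v : H u v = H v u.
Proof. by rewrite /bipartite_kneser eq_sym orbC. Qed.

Lemma adj_same_card u v : #|val u| = #|val v| -> ~~ H u v.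
Proof.
move=> uv; rewrite /bipartite_kneser -val_eqE.
by apply/andP=> -[/negP uNv] /orP[] suv; case: uNv; [|rewrite eq_sym];
  rewrite eqEcard suv uv leqnn.
Qed.

Lemma adj_small_large u v :
  #|val u| = k -> #|val v| = n - k -> H u v = (val u \subset val v).
Proof.
move=> uk vk; rewrite /bipartite_kneser -val_eqE.
have -> : (val v \subset val u) = false.
  by apply/negP=> /subset_leq_card; rewrite uk vk; lia.
rewrite orbF andb_idl // => _; apply/eqP=> uv; move: vk; rewrite -uv uk; lia.
Qed.

Lemma vertex_cases v : #|val v| = k \/ #|val v| = n - k.
Proof. by case: v => A /= /orP[]/eqP; [left|right]. Qed.

Lemma adj_small_card u v : #|val u| = k -> H u v -> #|val v| = n - k.
Proof.
move=> uk; case: (vertex_cases v) => // vk.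
by rewrite (negbTE (adj_same_card _)) // uk vk.
Qed.

(** The large sets through which a shortest path may pass when [X] blocks its
    own members.  Blocks are kept as sets rather than vertices, so that the
    family can be compared with a covering; for the small layer one takes
    [unblocked (compl @: X)]. *)
Definition unblocked X : {set {set 'I_n}} :=
  [set B : {set 'I_n} | #|B| == n - k] :\: [set val v | v in X].

Lemma unblockedP X v : #|val v| = n - k -> (val v \in unblocked X) = (v \notin X).
Proof. by move=> vk; rewrite !inE vk eqxx andbT mem_imset //; apply: val_inj. Qed.

Lemma unblocked_card X B : B \in unblocked X -> #|B| = n - k.
Proof. by rewrite !inE => /andP[_ /eqP]. Qed.

(** The second set contains the points missed by the first; as [k < #|T|] there
    are some, so the two sets differ. *)
Lemma two_subsets T : k < #|T| <= 2 * k ->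
  exists A1 A2, [/\ #|A1| = k, #|A2| = k, A1 != A2 & A1 :|: A2 = T].
Proof.
move=> /andP[kT Tk].
have [|A1 /andP[_ A1T] A1k] := @set_between _ set0 T k (sub0set T).
  by rewrite cards0 (ltnW kT).
have cD : #|T :\: A1| = #|T| - k by rewrite cardsDS ?A1k.
have [|A2 /andP[DA2 A2T] A2k] := @set_between _ (T :\: A1) T k (subsetDl T A1).
  by rewrite cD; lia.
exists A1, A2; split=> //.
  apply/eqP=> A12; have : T :\: A1 \subset set0.
    apply/subsetP=> x xD; have := subsetP DA2 _ xD.
    by rewrite -A12; move: xD; rewrite inE => /andP[/negbTE->].
  by rewrite subset0 -cards_eq0 cD; lia.
apply/eqP; rewrite eqEsubset subUset A1T A2T /=; apply/subsetP=> x xT.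
rewrite inE; case: (boolP (x \in A1)) => //= xA1.
by apply: (subsetP DA2); rewrite inE xA1.
Qed.

(** Writing [T] as the union of two distinct small vertices puts them at
    distance 2, with the large supersets of [T] as their common neighbours. *)
Lemma unblocked_superset X T :
    total_mutual_visibility_set H X -> k < #|T| <= 2 * k -> #|T| <= n - k ->
  exists2 B, B \in unblocked X & T \subset B.
Proof.
move=> tX Tk Tnk.
have [A1 [A2 [A1k A2k A12 defT]]] := two_subsets Tk.
have [|B /andP[TB _] Bk] := @set_between _ T setT (n - k) (subsetT T).
  by rewrite Tnk cardsT card_ord leq_subr.
have [A1T A2T] : A1 \subset T /\ A2 \subset T.
  by rewrite -defT subsetUl subsetUr.
have [||||z /andP[e1z ez2] zX] :=
    visible_at_distance2 (u := small A1k) (v := small A2k) (w := large Bk) adj_irr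
      _ _ _ _ (tX _ _).
- by rewrite -val_eqE.
- by apply: adj_same_card; rewrite /= A1k A2k.
- by rewrite adj_small_large //=; apply: subset_trans TB.
- by rewrite adj_sym adj_small_large //=; apply: subset_trans TB.
have zk := adj_small_card (A1k : #|val (small A1k)| = k) e1z.
exists (val z); first by rewrite unblockedP.
move: e1z ez2; rewrite [H z _]adj_sym !adj_small_large //= -defT subUset.
by move=> -> ->.
Qed.

Lemma unblocked_covering X : 3 * k <= n ->
  total_mutual_visibility_set H X -> is_covering (n - k) (2 * k) (unblocked X).
Proof.
move=> k3n tX; apply/andP; split.
  by apply/forallP=> B; apply/implyP=> /unblocked_card/eqP.
apply/forallP=> T; apply/implyP=> /eqP Tk.
have [||B BX TB] := unblocked_superset (T := T) tX; try by rewrite Tk; lia.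
by apply/existsP; exists B; rewrite BX.
Qed.

Lemma total_mutual_visibility_compl X :
  total_mutual_visibility_set H X -> total_mutual_visibility_set H (compl @: X).
Proof.
by apply: total_mutual_visibility_imset; [apply: complK | apply: adj_compl].
Qed.

Lemma imset_complK X : compl @: (compl @: X) = X.
Proof.
by rewrite -imset_comp (eq_imset (g := id)) ?imset_id //; apply: complK.
Qed.

Lemma visible_compl X u v :
  visible H (compl @: X) (compl u) (compl v) -> visible H X u v.
Proof.
move/(visible_imset complK adj_compl).
by rewrite imset_complK !complK.
Qed.

(** A large set has between [k + 1] and [2 * k] elements here, and is the only
    large set containing itself, so it is never blocked. *)
Lemma total_mutual_visibility_set_empty X :
  n <= 3 * k -> total_mutual_visibility_set H X -> X = set0.
Proof.
move=> n3k.
have no_large Y v : total_mutual_visibility_set H Y -> #|val v| = n - k -> v \notin Y.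
  move=> tY vk; have [||B BY vB] := unblocked_superset (T := val v) tY.
  - by rewrite vk; lia.
  - by rewrite vk.
  have Bk := unblocked_card BY.
  suff -> : v = large Bk by rewrite -unblockedP.
  by apply/val_inj/eqP; rewrite eqEcard vB /= Bk vk leqnn.
move=> tX; apply/setP=> v; rewrite inE; apply/negbTE.
case: (vertex_cases v) => vk; last exact: no_large.
rewrite -(mem_imset _ _ (inv_inj complK)); apply: no_large.
  exact: total_mutual_visibility_compl.
by rewrite /= cardsC_ord vk.
Qed.

Section Coverings.
Hypothesis k3n : 3 * k <= n.
Variable X : {set vertex}.
Hypotheses (covX : is_covering (n - k) (2 * k) (unblocked X))
           (covCX : is_covering (n - k) (2 * k) (unblocked (compl @: X))).

Lemma large_neighbor T : #|T| <= 2 * k ->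
  exists w, [/\ #|val w| = n - k, w \notin X & T \subset val w].
Proof.
move=> Tk; have [|B BX TB] := covering_superset _ covX Tk; first by lia.
have Bk := unblocked_card BX.
by exists (large Bk); rewrite -unblockedP.
Qed.

Lemma small_neighbor T : #|T| <= 2 * k ->
  exists w, [/\ #|val w| = k, w \notin X & [disjoint val w & T]].
Proof.
move=> Tk; have [|B BX TB] := covering_superset _ covCX Tk; first by lia.
have Bk := unblocked_card BX.
exists (compl (large Bk)); split.
- by rewrite /= cardsC_ord Bk; lia.
- by rewrite -(mem_imset _ _ (inv_inj complK)) complK -unblockedP.
- by rewrite disjoint_sym disjoints_subset setCK.
Qed.

Lemma visible_small_small u v : #|val u| = k -> #|val v| = k -> visible H X u v.
Proof.
move=> uk vk; have [->|neq] := eqVneq u v; first exact: visible_refl.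
have [|w [wk wX]] := @large_neighbor (val u :|: val v).
  by rewrite (leq_trans (leq_card_setU _ _)) // uk ?w2k ?vk addnn mul2n.
rewrite subUset => /andP[uw vw].
apply: visible_path2 neq _ _ _ wX.
- by apply: adj_same_card; rewrite uk vk.
- by rewrite adj_small_large.
- by rewrite adj_sym adj_small_large.
Qed.

(** The path is built from its far end: first a small set [w2] inside
    [val v], which amounts to avoiding the [k] points outside [val v], and then
    a large set containing the at most [2 * k] points of [val u] and [val w2].
    An edge joins the two layers, so the distance is odd and a path of length 3
    between nonadjacent vertices is shortest. *)
Lemma visible_small_large u v : #|val u| = k -> #|val v| = n - k -> visible H X u v.
Proof.
move=> uk vk.
have neq : u != v by apply/eqP=> uv; move: vk; rewrite -uv uk; lia.
have [adj|nadj] := boolP (H u v); first exact: visible_edge.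
have [|w2 [w2k w2X w2v]] := @small_neighbor (~: val v).
  by rewrite cardsC_ord vk; lia.
have [|w1 [w1k w1X]] := @large_neighbor (val u :|: val w2).
  by rewrite (leq_trans (leq_card_setU _ _)) // uk ?w2k ?vk addnn mul2n.
rewrite subUset => /andP[uw1 w21].
apply: (visible_path3 (w1 := w1) (w2 := w2)) => //.
- move=> w /(adj_small_card uk) wk.
  by apply: adj_same_card; rewrite wk.
- by rewrite adj_small_large.
- by rewrite adj_sym adj_small_large.
- by rewrite adj_small_large // -[val v]setCK -disjoints_subset.
Qed.

End Coverings.

Lemma covering_total_mutual_visibility X : 3 * k <= n ->
  is_covering (n - k) (2 * k) (unblocked X) ->
  is_covering (n - k) (2 * k) (unblocked (compl @: X)) ->
  total_mutual_visibility_set H X.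
Proof.
move=> k3n cX cCX u v.
have [uk|uk] := vertex_cases u; have [vk|vk] := vertex_cases v.
- exact: visible_small_small.
- exact: visible_small_large.
- apply: visible_compl; apply: visible_small_large; rewrite ?imset_complK //=.
    by rewrite cardsC_ord uk; lia.
  by rewrite cardsC_ord vk.
- apply: visible_compl; apply: visible_small_small; rewrite ?imset_complK //=.
    by rewrite cardsC_ord uk; lia.
  by rewrite cardsC_ord vk; lia.
Qed.

(** Each layer has ['C(n, k)] vertices; the large layer splits into [X] and
    [unblocked X], and complementation carries the small layer to the large
    one. *)
Lemma card_unblocked X :
  #|X| + #|unblocked X| + #|unblocked (compl @: X)| = 2 * 'C(n, k).
Proof.
pose L (Y : {set vertex}) : {set vertex} := [set v in Y | #|val v| == n - k].
have cardL Y : #|L Y| + #|unblocked Y| = 'C(n, k).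
  have <- : #|[set B : {set 'I_n} | #|B| == n - k]| = 'C(n, k).
    by rewrite card_draws card_ord bin_sub //; lia.
  rewrite -(cardsID [set val v | v in Y]); congr addn.
  rewrite -(card_imset _ val_inj); apply: eq_card => B.
  rewrite inE; apply/imsetP/andP=> [[v vY ->]|[Bk /imsetP[v vY BE]]].
    by move: vY; rewrite !inE => /andP[vY ->]; rewrite imset_f.
  by exists v => //; move: Bk; rewrite !inE vY -BE.
have -> : #|X| = #|L X| + #|L (compl @: X)|.
  rewrite -(cardsID [set v : vertex | #|val v| == n - k]); congr addn.
    by apply: eq_card => v; rewrite !inE.
  rewrite -(card_imset _ (inv_inj complK)); apply: eq_card => v.
  rewrite -{1}(complK v) mem_imset ?inE; last exact: inv_inj complK.
  rewrite -[in RHS](complK v) mem_imset; last exact: inv_inj complK.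
  rewrite complK andbC; congr andb; rewrite /= cardsC_ord.
  by case: (vertex_cases v) => ->; lia.
by rewrite mul2n -addnn -{1}(cardL X) -(cardL (compl @: X)); lia.
Qed.

(** Each of the two coverings outside a total mutual-visibility set has at least
    the minimum number of blocks.  A minimum covering [B] can serve as both at
    once, for the set of the vertices that are neither in [B] nor the
    complement of a member of [B]. *)
Lemma total_mutual_visibility_number_covering : 3 * k <= n ->
  total_mutual_visibility_number H + 2 * covering_number n (n - k) (2 * k)
    = 2 * 'C(n, k).
Proof.
move=> k3n; have [cle catt] : 2 * k <= n - k /\ n - k <= n by lia.
have [B cB Bmin] := covering_number_attained cle catt.
pose X : {set vertex} := [set v | (val v \notin B) && (~: val v \notin B)].
have CX : compl @: X = X.
  apply/setP=> v; rewrite -[in LHS](complK v) mem_imset; last exact: inv_inj complK.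
  by rewrite !inE /= setCK andbC.
have UX : unblocked X = B.
  apply/setP=> A; apply/idP/idP=> [AX|AB].
    have Ak := unblocked_card AX.
    move: AX; rewrite (unblockedP X (v := large Ak)) // inE /= negb_and !negbK.
    case/orP=> // CA; have := covering_block_card cB CA.
    by rewrite cardsC_ord Ak; lia.
  have Ak := covering_block_card cB AB.
  by rewrite (unblockedP X (v := large Ak)) // inE /= AB.
have tX : total_mutual_visibility_set H X.
  by apply: covering_total_mutual_visibility; rewrite ?CX ?UX.
apply/eqP; rewrite eqn_leq; apply/andP; split.
  rewrite addnC -leq_subRL; last first.
    by rewrite -(card_unblocked X) CX UX Bmin mul2n -addnn -addnA leq_addl.
  apply/bigmax_leqP=> Y /asboolP tY.
  rewrite -(card_unblocked Y) -addnA -addnBA ?leq_addr // mul2n -addnn leq_add //.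
    exact/covering_number_le/unblocked_covering.
  exact/covering_number_le/unblocked_covering/total_mutual_visibility_compl.
rewrite -(card_unblocked X) CX UX Bmin (mul2n (covering_number _ _ _)) -addnn.
rewrite addnA !leq_add2r.
by apply: (bigmax_sup X) => //; apply/asboolP.
Qed.

Lemma total_mutual_visibility_number_eq0 :
  n <= 3 * k -> total_mutual_visibility_number H = 0.
Proof.
move=> n3k; apply/eqP; rewrite -leqn0; apply/bigmax_leqP=> X /asboolP.
by move/(total_mutual_visibility_set_empty n3k)->; rewrite cards0.
Qed.

End BipartiteKneser.

Theorem theorem8 (n k : nat) (hk : 2 <= k) (hn : 2 * k + 1 <= n) :
  let mu_t := total_mutual_visibility_number (@bipartite_kneser n k) in
  [/\ 2 * k + 1 <= n <= 3 * k ->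
        mu_t = 0,
      3 * k + 1 <= n < 2 * k ^ 2 + k ->
        (mu_t%:Z = 2 * 'C(n, k)%:Z - 2 * (covering_number n (n - k) (2 * k))%:Z)%R
    & 2 * k ^ 2 + k <= n ->
        (mu_t%:Z = 2 * 'C(n, k)%:Z - 4 * k%:Z - 2)%R].
Proof.
move=> mu_t; have k0 : 0 < k by lia.
have k2n : 2 * k < n by lia.
split=> [/andP[_ n3k]|/andP[k3n _]|kn].
- exact: total_mutual_visibility_number_eq0.
- have := total_mutual_visibility_number_covering k0 k2n; rewrite -/mu_t; lia.
have k3n : 3 * k <= n by nia.
have := total_mutual_visibility_number_covering k0 k2n k3n; rewrite -/mu_t.
rewrite covering_number_disjoint_complements //; [lia | nia].
Qed.
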